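(* There exist CE-Pisot numbers $\beta$ for which condition $(F_1)$, namely $\mathbb{N}\subset\mathrm{Fin}(\beta)$, holds.
   Context: For a real non-integer $\beta>1$, the $\beta$-expansion of $x\in[0,1]$ is the digit sequence $e_k(x)=\lfloor \beta T_\beta^{k-1}(x)\rfloor$ where $T_\beta(x)=\beta x-\lfloor\beta x\rfloor$, so $x=\sum_{k\ge1}e_k(x)\beta^{-k}$; for $x>1$, with $L$ the least natural number such that $x\le\beta^L$, the $\beta$-expansion of $x$ is that of $x/\beta^L$ shifted $L$ places to the left. $\mathrm{Fin}(\beta)$ is the set of numbers whose $\beta$-expansion has finitely many nonzero digits. A Pisot number is a real algebraic integer $>1$ whose other conjugates all have modulus $<1$. If the $\beta$-expansion of $1$ is finite, $a_1\ldots a_n$ with $a_n\ne0$, then $\beta$ is a CE-Pisot number if it is Pisot, $(a_i)_{1\le i\le n}$ is not monotonic, and $a_k=0$ for some $1<k<n$. *)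

(* Defs.v *)
From HB Require Import structures.
From mathcomp Require Import all_boot all_order all_algebra.
From mathcomp Require Import complex.
From mathcomp Require Import boolp classical_sets functions cardinality reals.

Set Implicit Arguments.
Unset Strict Implicit.
Unset Printing Implicit Defensive.

Import Order.TTheory GRing.Theory Num.Theory.

Local Open Scope classical_set_scope.
Local Open Scope ring_scope.

Section BetaExpansion.
Variables (R : realType) (b : R).

Definition beta_transf (x : R) : R := b * x - (Num.floor (b * x))%:~R.

(* The digit e_k(x) for x in [0, 1]; meaningful for k >= 1 only. *)
Definition beta_digit (x : R) (k : nat) : int :=
  Num.floor (b * iter k.-1 beta_transf x).

(* The least L with x <= b ^ L, which exists as soon as 1 < b; it is 0 when
   x <= 1. *)
Definition beta_level (x : R) : nat :=
  xget 0%N [set L | x <= b ^+ L /\ forall m, x <= b ^+ m -> (L <= m)%N].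

(* The coefficient of b ^ (- k) in the expansion of x >= 0: shifting L places
   to the left moves the digit of index k + L to index k. *)
Definition beta_expansion (x : R) (k : int) : int :=
  let L := beta_level x in
  if 0 < k + L%:Z then beta_digit (x / b ^+ L) (absz (k + L%:Z)) else 0.

Definition Fin : set R :=
  [set x | 0 <= x /\ finite_set [set k : int | beta_expansion x k != 0]].

Definition F1 : Prop := range (fun n : nat => n%:R) `<=` Fin.

Definition beta_expansion1_finite (n : nat) : Prop :=
  [/\ (0 < n)%N, beta_digit 1 n != 0 &
      forall k, (n < k)%N -> beta_digit 1 k = 0].

End BetaExpansion.

Section Pisot.
Variable R : realType.

Definition is_minpoly (x : R) (p : {poly rat}) : Prop :=
  [/\ p \is monic, irreducible_poly p & root (map_poly ratr p) x].

Definition conjugate (x : R) (z : R[i]) : Prop :=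
  exists2 p : {poly rat}, is_minpoly x p & root (map_poly ratr p) z.

Definition Pisot (b : R) : Prop :=
  [/\ 1 < b, integralOver (intr : int -> R) b &
      forall z : R[i], conjugate b z -> z <> b%:C%C -> `|z| < 1].

Definition monotonic (s : seq int) : bool :=
  sorted (fun i j => i <= j) s || sorted (fun i j => j <= i) s.

Definition CE_Pisot (b : R) : Prop :=
  Pisot b /\
  exists n, [/\ beta_expansion1_finite b n,
                ~~ monotonic [seq beta_digit b 1 k | k <- iota 1 n] &
                exists2 k, (1 < k < n)%N & beta_digit b 1 k = 0].

End Pisot.

(* Main.v *)
(** Take the root b > 3 of X^3 - 3 X^2 - 1, for which 1 has the expansion 3 0 1.
    As b is a unit, b^-1 = b^2 - 3 b, the ring Z[1/b] consists of the numbers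
    c + z0 / b + z1 / b^2 with integer c, z0, z1, and it contains n / b^L.
    If such a number lies in [0, 1), then T_b sends it to
    c' + z1 / b + c / b^2 for some integer c'.  Since 1/b + 1/b^2 < 1/2, being
    in [0, 1) forces |c| < 1 + max(|z0|, |z1|) / 2; hence max(|z0|, |z1|)
    decreases every two steps until it is at most 1.  From then on c is 0 or 1,
    and the orbit soon reaches 0. *)

Require Import Defs.
From mathcomp Require Import all_boot all_order all_algebra.
From mathcomp Require Import complex.
From mathcomp Require Import boolp classical_sets functions cardinality reals.
From mathcomp Require Import zify ring lra.

Import Order.TTheory GRing.Theory Num.Theory.

Local Open Scope ring_scope.

(** * Finite orbits and finite expansions *)

Lemma beta_transf_ge0_lt1 (R : realType) (b x : R) :
  0 <= beta_transf b x < 1.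
Proof.
rewrite /beta_transf subr_ge0 floor_le /= ltrBlDl.
by have := floorD1_gt (b * x); rewrite intrD.
Qed.

Lemma iter_beta_transf0 (R : realType) (b : R) (n : nat) :
  iter n (beta_transf b) 0 = 0.
Proof. by elim: n => // n IH; rewrite iterS IH /beta_transf mulr0 floor0 subr0. Qed.

Lemma beta_digit_eventually0 (R : realType) (b x : R) (n k : nat) :
  iter n (beta_transf b) x = 0 -> (n < k)%N -> beta_digit b x k = 0.
Proof.
case: k => // k xn0; rewrite ltnS => le_nk.
by rewrite /beta_digit /= -(subnK le_nk) iterD xn0 iter_beta_transf0 mulr0 floor0.
Qed.

Lemma finite_beta_expansion (R : realType) (b x : R) (n : nat) :
  iter n (beta_transf b) (x / b ^+ beta_level b x) = 0 ->
  finite_set [set k : int | beta_expansion b x k != 0]%classic.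
Proof.
set L := beta_level b x => xn0.
(* A nonzero digit at index [k] is the digit of the scaled number at [j = k + L], and [j <= n]
   because later digits vanish. *)
apply: (@sub_finite_set _ _ ((fun j : nat => j%:Z - L%:Z) @` `I_n.+1)%classic).
  move=> k /=; rewrite /beta_expansion -/L; case: ifP => [k_gt0|_]; last first.
    by rewrite eqxx.
  move=> dk; exists (absz (k + L%:Z)); last by lia.
  rewrite ltnS leqNgt; apply/negP => lt_nk.
  by rewrite (@beta_digit_eventually0 _ _ _ n) ?eqxx in dk.
exact/finite_image/finite_II.
Qed.

(** The gcd computed over [F] still vanishes at [x], so it is not constant and must be associate to
    [p]. *)
Lemma irreducible_dvdp_of_common_root (F : fieldType) (K : fieldType)
    (f : {rmorphism F -> K}) (p q : {poly F}) (x : K) :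
  irreducible_poly p -> root (map_poly f p) x -> root (map_poly f q) x ->
  p %| q.
Proof.
move=> [_ irr_p] px qx.
have gx : root (map_poly f (gcdp p q)) x by rewrite gcdp_map root_gcd px.
have sg : size (gcdp p q) != 1%N.
  apply/negP => /size_poly1P [c c0 gE].
  by move: gx; rewrite gE map_polyC rootC fmorph_eq0 (negPf c0).
by rewrite -(eqp_dvdl _ (irr_p _ sg (dvdp_gcdl p q))) dvdp_gcdr.
Qed.

(** * The dynamics of [beta_transf] on Z[1/b] *)

Section Base301.
Variables (R : realType) (b : R).
Hypotheses (b_gt3 : 3 < b) (b_root : b ^+ 3 = 3 * b ^+ 2 + 1).

Let u : R := b^-1.

Let b_neq0 : b != 0. Proof. by rewrite lt0r_neq0 ?(lt_trans _ b_gt3). Qed.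

Let ub : u * b = 1. Proof. exact: mulVf. Qed.

Let u_gt0 : 0 < u. Proof. by rewrite /u invr_gt0 (lt_trans _ b_gt3). Qed.

Let u_lt : u < 1 / 3.
Proof.
have : 0 < u * (b - 3) by rewrite mulr_gt0 ?u_gt0 ?subr_gt0.
by rewrite mulrBr ub; lra.
Qed.

Let u2_lt : 0 < u ^+ 2 < 1 / 9.
Proof. by have ? := u_gt0; have ? := u_lt; nra. Qed.

Let bE : b = 3 + u ^+ 2.
Proof.
apply: (mulIf (expf_neq0 2 b_neq0)).
rewrite mulrDl -exprMn ub expr1n -b_root; ring.
Qed.

Let u3E : u ^+ 3 = 1 - 3 * u.
Proof. have := ub; rewrite {1}bE mulrDr -exprS => ?; lra. Qed.

Lemma base301_nonint : b \isn't a Num.int.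
Proof.
apply/negP => /intrP[m mE].
have := bE; have /andP[? ?] := u2_lt; rewrite mE => ?.
have : (3%:~R : R) < m%:~R by lra.
have : (m%:~R : R) < 4%:~R by lra.
rewrite !ltr_int; lia.
Qed.

(** For values in [0, 1), [c] is minus the floor of [z0 * u + z1 * u ^+ 2], so (z0, z1) -> (z1, c)
    is the shift radix system with parameter (u, u^2). *)
Definition base301_comb (c z0 z1 : int) : R :=
  c%:~R + z0%:~R * u + z1%:~R * u ^+ 2.

Lemma base301_comb_div (c z0 z1 : int) :
  base301_comb c z0 z1 / b = base301_comb z1 (c - 3 * z1) z0.
Proof.
rewrite /base301_comb -/u !(intrD, intrM, rmorphN, rmorphB) /=.
have -> : (c%:~R + z0%:~R * u + z1%:~R * u ^+ 2) * u =
  c%:~R * u + z0%:~R * u ^+ 2 + z1%:~R * u ^+ 3 by ring.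
rewrite u3E; ring.
Qed.

Lemma base301_nat_div (n L : nat) :
  exists c z0 z1, n%:R / b ^+ L = base301_comb c z0 z1.
Proof.
elim: L => [|L [c [z0 [z1 IH]]]].
  by exists n%:Z, 0, 0; rewrite expr0 divr1 /base301_comb !mul0r !addr0.
exists z1, (c - 3 * z1), z0.
by rewrite exprSr invfM mulrA IH base301_comb_div.
Qed.

Lemma base301_transf_comb (c z0 z1 : int) :
  exists c', beta_transf b (base301_comb c z0 z1) = base301_comb c' z1 c.
Proof.
rewrite /beta_transf; set m := Num.floor _.
(* Since [b = 3 + u ^+ 2], the term [c * b] contributes [3 * c] to the integer part and [c] to the
   coefficient of [u ^+ 2]. *)
exists (3 * c + z0 - m); rewrite /base301_comb.
rewrite !(intrD, intrM, rmorphN, rmorphB) /=.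
have -> : b * (c%:~R + z0%:~R * u + z1%:~R * u ^+ 2) =
  c%:~R * b + z0%:~R * (u * b) + z1%:~R * u * (u * b) by ring.
rewrite ub bE; ring.
Qed.

(** As u < 1/3 and u^2 < 1/9, the terms in [z0] and [z1] add up to at most 4M/9 in absolute value;
    the factor 9 keeps the bound integral. *)
Lemma base301_comb_bound (c z0 z1 M : int) :
  `|z0| <= M -> `|z1| <= M -> 0 <= base301_comb c z0 z1 < 1 ->
  - (4 * M) <= 9 * c < 9 + 4 * M.
Proof.
move=> z0M z1M; have M_ge0 : 0 <= M by apply: le_trans z0M.
rewrite /base301_comb => /andP[x_ge0 x_lt1].
move: z0M z1M; rewrite -!(ler_int R) !intr_norm !ler_norml.
move=> /andP[? ?] /andP[? ?].
have ? := u_gt0; have ? := u_lt; have /andP[? ?] := u2_lt.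
have MR_ge0 : (0 : R) <= M%:~R by rewrite ler0z.
have h0 : z0%:~R * u <= M%:~R / 3 by nra.
have h1 : z1%:~R * u ^+ 2 <= M%:~R / 9 by nra.
have h0' : - (M%:~R / 3) <= z0%:~R * u by nra.
have h1' : - (M%:~R / 9) <= z1%:~R * u ^+ 2 by nra.
rewrite -(ltr_int R) rmorphN intrD !intrM /=.
by apply/andP; split; lra.
Qed.

(** The previous bound with M = 1 gives -4 <= 9c, hence c >= 0; the other two terms being
    nonnegative, c is at most the value, which is below 1. *)
Lemma base301_comb_nneg (c z0 z1 : int) :
  0 <= z0 <= 1 -> 0 <= z1 <= 1 -> 0 <= base301_comb c z0 z1 < 1 -> c = 0.
Proof.
move=> z0b z1b x01.
have z0_le1 : `|z0| <= 1 by lia.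
have z1_le1 : `|z1| <= 1 by lia.
have := base301_comb_bound _ _ _ _ z0_le1 z1_le1 x01.
have : c < 1; last by clear; lia.
move: z0b z1b x01 => /andP[z0_ge0 _] /andP[z1_ge0 _] /andP[_ x_lt1].
rewrite -(ltr_int R); apply: le_lt_trans x_lt1.
rewrite /base301_comb -addrA lerDl.
by rewrite addr_ge0 // mulr_ge0 ?ler0z // ltW // exprn_gt0.
Qed.

(** Each step shifts a zero into the last coordinate, so after two steps all three are zero. *)
Lemma base301_orbit0_nneg (c z0 z1 : int) :
  0 <= z0 <= 1 -> 0 <= z1 <= 1 -> 0 <= base301_comb c z0 z1 < 1 ->
  iter 2 (beta_transf b) (base301_comb c z0 z1) = 0.
Proof.
move=> z0b z1b x01; rewrite (base301_comb_nneg _ _ _ z0b z1b x01) /=.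
have [c' E1] := base301_transf_comb 0 z0 z1.
have := beta_transf_ge0_lt1 R b (base301_comb 0 z0 z1).
rewrite E1 => x01'; rewrite (base301_comb_nneg c' z1 0) //.
have [c'' E2] := base301_transf_comb 0 z1 0.
have := beta_transf_ge0_lt1 R b (base301_comb 0 z1 0).
rewrite E2 => x01''; rewrite (base301_comb_nneg c'' 0 0) //.
by rewrite /base301_comb !mul0r !addr0.
Qed.

Lemma base301_orbit0 (c z0 z1 : int) :
  0 <= base301_comb c z0 z1 < 1 ->
  exists n, iter n (beta_transf b) (base301_comb c z0 z1) = 0.
Proof.
have [M] := ubnP (maxn (absz z0) (absz z1)).
elim: M => // M IH in c z0 z1 *; rewrite ltnS geq_max => /andP[z0M z1M] x01.
have [c' E1] := base301_transf_comb c z0 z1.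
have := beta_transf_ge0_lt1 R b (base301_comb c z0 z1).
rewrite E1 => x01'.
have [c'' E2] := base301_transf_comb c' z1 c.
have := beta_transf_ge0_lt1 R b (base301_comb c' z1 c).
rewrite E2 => x01''.
have z0MZ : `|z0| <= M%:Z by rewrite -abszE lez_nat.
have z1MZ : `|z1| <= M%:Z by rewrite -abszE lez_nat.
have cb := base301_comb_bound _ _ _ _ z0MZ z1MZ x01.
(* If M <= 1, the bounds put [c] and [c'] in {0, 1}, and two further steps reach 0. If M >= 2, then
   9 + 4M < 9M, so both are below M in absolute value and the induction applies. *)
have [M1|M2] := leqP M 1.
  have z1_le1 : `|z1| <= 1 by clear -z1MZ M1; lia.
  have c_le1 : `|c| <= 1 by clear -cb M1; lia.
  have cb' := base301_comb_bound _ _ _ _ z1_le1 c_le1 x01'.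
  exists 4%N; rewrite (iterD 2 2) /= E1 E2.
  by apply: base301_orbit0_nneg x01''; [clear -cb M1|clear -cb']; lia.
have cM : `|c| <= M%:Z by clear -cb M2; lia.
have cb' := base301_comb_bound _ _ _ _ z1MZ cM x01'.
have [||n n0] := IH c'' c c' => //; first by clear -cb cb' M2; lia.
by exists (n + 2)%N; rewrite iterD /= E1 E2.
Qed.

Lemma base301_F1 : F1 b.
Proof.
move=> _ [N _ <-]; split; first exact: ler0n.
set L := beta_level b N%:R.
have [c [z0 [z1 xE]]] := base301_nat_div N L.
(* The scaled number may equal 1, as for N = 1; one step of [beta_transf] brings it into [0, 1). *)
have [c' E] := base301_transf_comb c z0 z1.
have := beta_transf_ge0_lt1 R b (base301_comb c z0 z1).
rewrite E => /base301_orbit0[n n0].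
by apply: (@finite_beta_expansion _ _ _ n.+1); rewrite -/L xE iterSr E.
Qed.

(** * The Pisot property and the expansion of 1 *)

Definition base301_poly (A : nzRingType) : {poly A} := 'X^3 - 3%:P * 'X^2 - 1.

Lemma map_base301_poly (A B : nzRingType) (f : {rmorphism A -> B}) :
  map_poly f (base301_poly A) = base301_poly B.
Proof.
by rewrite /base301_poly !rmorphB !rmorphM /= map_polyX map_polyC /= !rmorph_nat rmorph1.
Qed.

Lemma base301_poly_monic (A : nzRingType) : base301_poly A \is monic.
Proof.
rewrite /base301_poly -addrA -opprD monicE lead_coefDl ?lead_coefXn //.
rewrite size_polyN size_polyXn ltnS; apply: (leq_trans (size_polyD _ _)).
rewrite size_poly1 geq_max andbT mul_polyC.
by rewrite (leq_trans (size_scale_leq _ _)) ?size_polyXn.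
Qed.

Lemma horner_base301_poly (A : comNzRingType) (x : A) :
  (base301_poly A).[x] = x ^+ 3 - 3 * x ^+ 2 - 1.
Proof.
by rewrite !(hornerD, hornerN) mul_polyC hornerZ !hornerXn hornerC.
Qed.

Lemma root_base301_poly (A : comNzRingType) (x : A) :
  root (base301_poly A) x = (x ^+ 3 - 3 * x ^+ 2 - 1 == 0).
Proof. by rewrite /root horner_base301_poly. Qed.

(** Dividing the cubic by X - b leaves X^2 + u^2 X + u, so |z|^2 <= u^2 |z| + u. If |z| >= 1, the
    right side is at most |z|/9 + |z|/3 < |z|^2. *)
Lemma base301_conjugate_lt1 (z : R[i]) :
  root (base301_poly _) z -> z <> b%:C%C -> `|z| < 1.
Proof.
rewrite root_base301_poly => /eqP z_root z_neq_b.
pose v := (u%:C)%C; pose B := (b%:C)%C.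
have vB : v * B = 1 by rewrite -rmorphM /= ub.
have BE : B = 3 + v ^+ 2 by rewrite /B {1}bE rmorphD rmorphXn /= rmorph_nat.
have quad : z ^+ 2 = - (v ^+ 2 * z + v).
  have zB : z - B != 0 by rewrite subr_eq0; apply/eqP.
  apply/eqP; rewrite -addr_eq0 -(mulrI_eq0 _ (mulfI zB)) -z_root; apply/eqP.
  have -> : (z - B) * (z ^+ 2 + (v ^+ 2 * z + v)) =
    z ^+ 3 - (B - v ^+ 2) * z ^+ 2 + v * (1 - v * B) * z - v * B by ring.
  by rewrite vB BE; ring.
have [t zE] : exists t : R, `|z| = (t%:C)%C.
  by exists (complex.Re `|z|); rewrite RRe_real ?normr_real.
have vE : `|v| = v by rewrite ger0_norm // lecR; exact: ltW.
have : `|z| ^+ 2 <= v ^+ 2 * `|z| + v.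
  by rewrite -normrX quad normrN (le_trans (ler_normD _ _)) // normrM normrX vE.
have : 0 <= `|z| by [].
rewrite zE -!rmorphXn -rmorphM -rmorphD /= !lecR ltcR => t_ge0 t_le.
rewrite ltNge; apply/negP => t_ge1.
have ? := u_lt; have /andP[_ ?] := u2_lt.
have : u ^+ 2 * t <= t / 9 by nra.
have : u <= t / 3 by lra.
have : t <= t ^+ 2 by rewrite expr2 ler_peMl.
lra.
Qed.

Lemma base301_root : root (base301_poly R) b.
Proof. by rewrite root_base301_poly b_root; apply/eqP; ring. Qed.

Lemma base301_Pisot : Pisot b.
Proof.
split; first by have ? := b_gt3; lra.
  exists (base301_poly int); first exact: base301_poly_monic.
  by rewrite map_base301_poly base301_root.
move=> z [p [_ p_irr pb] pz] z_neq_b.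
apply: base301_conjugate_lt1 => //.
(* A minimal polynomial of [b] shares the root [b] with the cubic, so each conjugate is a root of
   the cubic. *)
have p_dvd : p %| base301_poly rat.
  apply: (@irreducible_dvdp_of_common_root _ R ratr p _ b) => //.
  by rewrite map_base301_poly base301_root.
case/dvdpP: p_dvd => r rE.
rewrite -(map_base301_poly rat _ ratr) rE rmorphM.
by rewrite rootM pz orbT.
Qed.

(** The orbit of 1 is 1, u^2, u, 0. *)
Lemma base301_orbit1 :
  [/\ beta_digit b 1 1 = 3, beta_digit b 1 2 = 0, beta_digit b 1 3 = 1 &
      iter 3 (beta_transf b) 1 = 0].
Proof.
have /andP[u2_gt0 u2_lt1] := u2_lt.
have f1 : Num.floor (b * 1) = 3.
  by apply: floor_def; rewrite mulr1 bE; apply/andP; split; lra.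
have t1 : beta_transf b 1 = u ^+ 2.
  by rewrite /beta_transf f1 mulr1 {1}bE; ring.
have bu2 : b * u ^+ 2 = u by rewrite expr2 mulrA [b * u]mulrC ub mul1r.
have f2 : Num.floor (b * u ^+ 2) = 0.
  by apply: floor_def; rewrite bu2; have ? := u_gt0; have ? := u_lt; lra.
have t2 : beta_transf b (u ^+ 2) = u by rewrite /beta_transf f2 bu2 subr0.
have f3 : Num.floor (b * u) = 1 by rewrite mulrC ub floor1.
have t3 : beta_transf b u = 0 by rewrite /beta_transf f3 mulrC ub subrr.
by rewrite /beta_digit /= t1 t2 t3 f1 f2 f3.
Qed.

Lemma base301_CE_Pisot : CE_Pisot b.
Proof.
have [d1 d2 d3 o3] := base301_orbit1.
split; first exact: base301_Pisot.
exists 3%N; split; last by exists 2%N.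
  by split=> [||k]; [|rewrite d3|exact: beta_digit_eventually0].
by rewrite /= d1 d2 d3.
Qed.

End Base301.

Lemma base301_exists (R : realType) :
  exists2 b : R, 3 < b & b ^+ 3 = 3 * b ^+ 2 + 1.
Proof.
(* The cubic takes the values -1 at 3 and 15 at 4. *)
have [|b /andP[b_ge3 _] b0] := @poly_ivt R (base301_poly R) 3 4 ltac:(lra).
  by rewrite !horner_base301_poly; lra.
have bE : b ^+ 3 = 3 * b ^+ 2 + 1.
  by move: b0; rewrite root_base301_poly => /eqP ?; lra.
exists b => //; rewrite lt_neqAle b_ge3 andbT; apply/eqP => b3.
by move: bE; rewrite -b3 => ?; lra.
Qed.

Theorem theorem1p2 (R : realType) :
  exists b : R, [/\ b \isn't a Num.int, CE_Pisot b & F1 b].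
Proof.
have [b b_gt3 b_root] := base301_exists R.
exists b; split.
- exact: base301_nonint.
- exact: base301_CE_Pisot.
- exact: base301_F1.
Qed.
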